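(* Let $X$ be a Tychonoff space all of whose separable closed subsets are $C^*$-embedded in $X$, and let $\mathbb{K}$ be a Peano continuum with more than one point. Then the following assertions are equivalent: 1. $C_p(X,[0,1])$ is Baire; 2. $C_p(X,\mathbb{K})$ is Baire.
   Context: For a space $Z$, $C_p(X,Z)$ is the set of all continuous maps $X\to Z$ with the topology of pointwise convergence (subspace topology from the product $Z^X$). A space is Baire if the intersection of any sequence of open dense subsets is dense. A subset $A\subseteq X$ is $C^*$-embedded in $X$ if every bounded continuous real-valued function on $A$ extends to a bounded continuous real-valued function on $X$. A Peano continuum is a connected, locally connected, compact metric space. *)

(* Defs.v *)
From HB Require Import structures.
From mathcomp Require Import all_boot all_order all_algebra.
From mathcomp Require Import all_classical all_reals all_analysis.

Set Implicit Arguments.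
Unset Strict Implicit.
Unset Printing Implicit Defensive.

Import Order.TTheory GRing.Theory Num.Theory.
Import numFieldNormedType.Exports.

Local Open Scope classical_set_scope.
Local Open Scope ring_scope.

(* A set [A : set T] used as a type is the sigma type [set_type A] with the
   subspace topology (see [subtype_topology]); this is the meaning of every
   subspace below. *)

(* Subspace of the product space Z^X (topology of pointwise convergence). *)
Definition Cp (X Z : topologicalType) : topologicalType :=
  set_type [set f : {ptws X -> Z} | continuous (f : X -> Z)].

Definition baire_space (T : topologicalType) : Prop :=
  forall U : (set T)^nat,
    (forall n, open (U n) /\ dense (U n)) -> dense (\bigcap_n U n).

Definition separable_space (T : topologicalType) : Prop :=
  exists2 D : set T, countable D & dense D.

(* [completely_regular_space] is phrased with uniformities; separation by a
   continuous function into [0, 1] is [uniform_separatorP]. *)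
Definition tychonoff_space (X : topologicalType) : Prop :=
  completely_regular_space X /\ hausdorff_space X.

Definition Cstar_embedded (R : realType) (X : topologicalType) (A : set X)
    : Prop :=
  forall f : set_type A -> R, continuous f -> bounded_fun f ->
    exists g : X -> R,
      [/\ continuous g, bounded_fun g & forall a : set_type A, g (\val a) = f a].

Definition locally_connected (T : topologicalType) : Prop :=
  forall (x : T) (U : set T), nbhs x U ->
    exists V : set T, [/\ open V, V x, connected V & V `<=` U].

Definition peano_continuum (R : realType) (K : metricType R) : Prop :=
  [/\ connected [set: K], locally_connected K & compact [set: K]].

Definition unit_interval (R : realType) : topologicalType :=
  set_type (`[0, 1]%classic : set R).

(* Main.v *)
(* Call a continuous map [h : Z -> K] feebly open if the image of every nonempty
   open set has nonempty interior.  If [h] is moreover surjective and both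
   [C_p(X, Z)] and [C_p(X, K)] realize arbitrary values at finitely many points,
   then composition with [h] pulls dense open subsets of [C_p(X, K)] back to
   dense open subsets of [C_p(X, Z)], so [C_p(X, K)] is Baire as soon as
   [C_p(X, Z)] is.  It remains to find feebly open surjections [0,1] -> K and
   K -> [0,1].
   For the first, refine the proof of the Hahn-Mazurkiewicz theorem: cover [K] by
   finer and finer chains of small connected open sets, each link carrying a
   closed core with nonempty interior that the next chain has to cover again;
   the limit curve then maps every cell of [0,1] onto a set containing a core.
   For the second, a continuous function that is constant on no nonempty open
   subset of [K] maps connected open sets to nondegenerate intervals. *)
Require Import Defs.
From mathcomp Require Import all_boot all_order all_algebra.
From mathcomp Require Import ring lra.
From mathcomp Require Import all_classical all_reals all_analysis.
Import Order.TTheory GRing.Theory Num.Theory.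
Import numFieldNormedType.Exports.
Local Open Scope classical_set_scope.
Local Open Scope ring_scope.

Set Implicit Arguments.
Unset Strict Implicit.
Unset Printing Implicit Defensive.

(** * Transfer of the Baire property along feebly open surjections *)

Section FunctionSpace.
Variables (X Z : topologicalType).

Definition box (s : seq X) (V : X -> set Z) : set (Cp X Z) :=
  [set f | forall x, x \in s -> V x ((\val f : X -> Z) x)].

Lemma Cp_continuous (f : Cp X Z) : continuous (\val f : X -> Z).
Proof. by have := valP f; rewrite inE. Qed.

(** The sets that contain a box around [f] form a filter on all of [X -> Z] which converges to [f]
    in every coordinate, hence in the product topology; restriction to continuous maps then gives
    the claim. *)
Lemma nbhs_Cp (f : Cp X Z) (A : set (Cp X Z)) : nbhs f A ->
  exists (s : seq X) (V : X -> set Z),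
    (forall x, open (V x) /\ V x ((\val f : X -> Z) x)) /\ box s V `<=` A.
Proof.
pose F : set_system {ptws X -> Z} := fun A => exists (s : seq X) (V : X -> set Z),
  (forall x, open (V x) /\ V x ((\val f : X -> Z) x)) /\
  (forall g, (forall x, x \in s -> V x (g x)) -> A g).
have FF : Filter F.
  split.
  - by exists [::], (fun=> setT); split => // x; split => //; exact: openT.
  - move=> P Q [s [V [oV sP]]] [t [W [oW tQ]]].
    exists (s ++ t), (fun x => V x `&` W x); split.
      move=> x; have [? ?] := oV x; have [? ?] := oW x.
      by split; [exact: openI|split].
    move=> g gVW; split; [apply: sP|apply: tQ] => x xs.
    by have [] := gVW x; rewrite // mem_cat xs.
    by have [] := gVW x; rewrite // mem_cat xs orbT.
  - move=> P Q PQ [s [V [oV sP]]]; exists s, V; split => // g /sP; exact: PQ.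
have Ff : F --> (\val f : {ptws X -> Z}).
  apply/cvg_sup => x B [_ [ [W oW <-] Wf] WB].
  exists [:: x], (fun y => if y == x then W else setT); split.
    by move=> y; case: eqP => [->|_]; split => //; exact: openT.
  by move=> g /(_ x); rewrite inE eqxx => /(_ isT) ?; exact: WB.
move=> [_ [ [W oW <-] /= Wf] WA].
have [s [V [oV sO]]] : F W by apply: Ff; exact: open_nbhs_nbhs.
by exists s, V; split => // g gV; apply: WA; exact: sO.
Qed.

Lemma Cp_eval_continuous (x : X) :
  continuous (fun f : Cp X Z => (\val f : X -> Z) x).
Proof.
move=> f; apply: (@continuous_comp _ {ptws X -> Z} _ (fun f : Cp X Z => \val f)
  (fun g => g x)).
  exact: initial_continuous.
exact: (@proj_continuous X (fun=> Z) x).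
Qed.

Lemma open_box s V : (forall x, open (V x)) -> open (box s V).
Proof.
move=> oV; elim: s => [|x s IH].
  suff -> : box [::] V = setT by exact: openT.
  by apply/seteqP; split.
have -> : box (x :: s) V =
    (fun f : Cp X Z => (\val f : X -> Z) x) @^-1` V x `&` box s V; last first.
  apply: openI => //; apply: open_comp => // f _; exact: Cp_eval_continuous.
apply/seteqP; split => [f fV|f [fx fV] y].
  split; first by apply: fV; rewrite mem_head.
  by move=> y ys; apply: fV; rewrite in_cons ys orbT.
by rewrite in_cons => /orP[/eqP->|]//; exact: fV.
Qed.

Definition mk_Cp (f : X -> Z) (cf : continuous f) : Cp X Z :=
  SigSub (mem_set cf : (f : {ptws X -> Z}) \in
    [set f : {ptws X -> Z} | continuous (f : X -> Z)]).

End FunctionSpace.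

(** Exact values, not just density of [Cp X Z] in the product: values are lifted along a surjection
    point by point, with no continuity in the choice. *)
Definition interpolating (X Z : topologicalType) :=
  forall (s : seq X) (z : X -> Z),
  exists2 f : X -> Z, continuous f & forall x, x \in s -> f x = z x.

Definition feebly_open (Z K : topologicalType) (h : Z -> K) :=
  forall U : set Z, open U -> U !=set0 -> (h @` U)° !=set0.

Lemma interpolating_image (X Z K : topologicalType) (h : Z -> K) :
  continuous h -> range h = setT -> interpolating X Z -> interpolating X K.
Proof.
move=> ch hs iZ s z.
have /choice[z' hz'] : forall x, exists t, h t = z x.
  by move=> x; have : range h (z x) by [rewrite hs]; case=> t _ <-; exists t.
have [f cf fz] := iZ s z'.
exists (h \o f); first by move=> x; apply: continuous_comp; [exact: cf|exact: ch].
by move=> x xs /=; rewrite fz.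
Qed.

Section Transfer.
Variables (X Z K : topologicalType) (h : Z -> K).
Hypotheses (ch : continuous h) (hs : range h = setT) (ho : feebly_open h).
Hypotheses (iZ : interpolating X Z).

Lemma comp_Cp_continuous (f : Cp X Z) : continuous (h \o (\val f : X -> Z)).
Proof. move=> x; apply: continuous_comp; [exact: Cp_continuous|exact: ch]. Qed.

Let hstar (f : Cp X Z) : Cp X K := mk_Cp (@comp_Cp_continuous f).

Lemma postcomp_continuous : continuous hstar.
Proof.
move=> f A /nbhs_Cp[s [V [oV sA]]].
apply: (@filterS _ _ _ (box s (fun x => h @^-1` V x))).
  by move=> g gV; apply: sA => x xs; exact: gV.
apply: open_nbhs_nbhs; split.
  apply: open_box => x; apply: open_comp; [by move=> ? _; exact: ch|].
  by case: (oV x).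
by move=> x _; case: (oV x).
Qed.

(** Preimages of the values of [g] are picked pointwise, inside [U x] when [x] is in [s], and
    interpolated on [s ++ t], where [t] supports a box around [g] inside [B]. *)
Lemma postcomp_lift s (U : X -> set Z) (g : Cp X K) (B : set (Cp X K)) :
  (forall x, x \in s -> (h @` U x) ((\val g : X -> K) x)) -> nbhs g B ->
  exists2 f, box s U f & B (hstar f).
Proof.
move=> sU /nbhs_Cp[t [V [oV tB]]].
have /choice[z hz] : forall x, exists z,
    h z = (\val g : X -> K) x /\ (x \in s -> U x z).
  move=> x; case: (boolP (x \in s)) => [/sU[z ? ?]|_]; first by exists z.
  have : range h ((\val g : X -> K) x) by rewrite hs.
  by case=> z _ <-; exists z.
have [f cf fz] := iZ (s ++ t) z.
exists (mk_Cp cf).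
  by move=> x xs; rewrite /= fz ?mem_cat ?xs//; apply: (hz x).2.
apply: tB => x xt; rewrite /= fz ?mem_cat ?xt ?orbT// (hz x).1.
by case: (oV x).
Qed.

Let iK : interpolating X K. Proof. exact: interpolating_image hs iZ. Qed.

(** By feeble openness the images of the [U x] have nonempty interiors [J x]. Interpolation into [K]
    makes the box of the [J x] nonempty, so it meets [G], and a common point lifts back into the box
    of the [U x]. *)
Lemma dense_postcomp_preimage (G : set (Cp X K)) :
  open G -> dense G -> dense (hstar @^-1` G).
Proof.
move=> oG dG O [f Of] oO.
have /nbhs_Cp[s [U [oU sO]]] : nbhs f O by exact: open_nbhs_nbhs.
pose J x := (h @` U x)°.
have oJ x : open (J x) by exact: open_interior.
have /choice[z Jz] x : exists z, J x z.
  have [oUx Ufx] := oU x.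
  by have [|y Jy] := ho oUx; [exists ((\val f : X -> Z) x)|exists y].
have [g0 cg0 g0z] := iK s z.
have [|g [gJ Gg]] := dG (box s J : set (Cp X K)) _ (open_box s oJ).
  by exists (mk_Cp cg0) => x xs /=; rewrite g0z.
have [|f' f'U Gf'] := @postcomp_lift s U g G _ (open_nbhs_nbhs (conj oG Gg)).
  by move=> x xs; apply: interior_subset; exact: gJ.
by exists f'; split => //; exact: sO.
Qed.

Lemma baire_postcomp : baire_space (Cp X Z) -> baire_space (Cp X K).
Proof.
move=> bZ U Uod O [g Og] oO.
(* The empty list imposes no constraint; this only shows that the preimage of [O] is nonempty. *)
have [//|f _ Of] := @postcomp_lift [::] (fun=> setT) g O _
  (open_nbhs_nbhs (conj oO Og)).
have hop A : open A -> open (hstar @^-1` A).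
  by move=> oA; apply: open_comp => // ? _; exact: postcomp_continuous.
have [|||f' [Of' Uf']] := bZ (fun n => hstar @^-1` U n) _ (hstar @^-1` O).
- by move=> n; have [? ?] := Uod n; split; [exact: hop|exact: dense_postcomp_preimage].
- by exists f.
- exact: hop.
by exists (hstar f'); split => // n _; exact: Uf'.
Qed.

End Transfer.

(** * Interpolation by functions into [0, 1] *)

(** Induction on [s]: a function [u] that is 0 at the new point and 1 on the old ones blends the old
    interpolant with the new value, and a convex combination stays in [0,1]. *)
Lemma tychonoff_interpolates_real (R : realType) (X : topologicalType) :
  tychonoff_space X -> forall (s : seq X) (z : X -> R),
  (forall x, 0 <= z x <= 1) ->
  exists2 f : X -> R, continuous f &
    (forall x, 0 <= f x <= 1) /\ forall x, x \in s -> f x = z x.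
Proof.
move=> [crX hX] s z z01; elim: s => [|x s [f cf [f01 fz]]].
  by exists (fun=> 0); [exact: cst_continuous|split => // _; rewrite lexx ler01].
have [xs|xNs] := boolP (x \in s).
  exists f => //; split => // y; rewrite in_cons => /orP[/eqP->|]; exact: fz.
have cs : closed [set` s].
  by apply: compact_closed => //; apply: finite_compact; exact: finite_seq.
have /(crX x _ cs)/(@uniform_separatorP _ R)[u [cu u01 ux us]] : ~ [set` s] x.
  by move=> /= xs; rewrite xs in xNs.
have {ux}ux : u x = 0 by apply: ux; exists x.
have {us}us y : y \in s -> u y = 1 by move=> ys; apply: us; exists y.
have {u01}u01 y : 0 <= u y <= 1.
  by have := u01 (u y); rewrite /= in_itv /=; apply; exists y.
exists (fun y => u y * f y + (1 - u y) * z x).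
  move=> y; apply: cvgD; first by apply: cvgM; [exact: cu|exact: cf].
  by apply: cvgM; [apply: cvgB; [exact: cvg_cst|exact: cu]|exact: cvg_cst].
split=> [y|y].
  have /andP[u0 u1] := u01 y; have /andP[f0 f1] := f01 y; have /andP[z0 z1] := z01 x.
  by apply/andP; split; nra.
rewrite in_cons => /orP[/eqP->|ys]; first by rewrite ux mul0r add0r subr0 mul1r.
by rewrite (us _ ys) mul1r subrr mul0r addr0 fz.
Qed.

Lemma continuous_sub (T Y : topologicalType) (A : set Y) (f : T -> set_type A) :
  continuous (fun t => \val (f t)) -> continuous f.
Proof. exact: continuous_comp_initial. Qed.

Lemma tychonoff_interpolating (R : realType) (X : topologicalType) :
  tychonoff_space X -> interpolating X (unit_interval R).
Proof.
move=> tX s z.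
have val01 (t : unit_interval R) : 0 <= (\val t : R) <= 1.
  by have := valP t; rewrite inE /= in_itv.
have [f cf [f01 fz]] := tychonoff_interpolates_real tX s (fun x => val01 (z x)).
have f01' x : f x \in (`[0, 1]%classic : set R) by rewrite inE /= in_itv /= f01.
exists (fun x => SigSub (f01' x) : unit_interval R).
  exact: continuous_sub.
by move=> x xs; apply: val_inj; rewrite /= fz.
Qed.

(** * Nowhere constant functions *)

Lemma expr_small (R : realType) (q e : R) :
  0 <= q < 1 -> 0 < e -> exists n, q ^+ n < e.
Proof.
move=> /andP[q0 q1] e0.
have /cvgr0Pnorm_lt/(_ _ e0) : q ^+ n @[n --> \oo] --> (0 : R).
  by apply: cvg_expr; rewrite ger0_norm.
by case=> n _ /(_ n (leqnn n)) /=; rewrite ger0_norm ?exprn_ge0// => ?; exists n.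
Qed.

Section SeparatePairs.
Variables (R : realType) (T : topologicalType) (u : nat -> T -> R) (a b : nat -> T).
Hypotheses (cu : forall n, continuous (u n)) (u01 : forall n x, 0 <= u n x <= 1).
Hypotheses (ua : forall n, u n (a n) = 0) (ub : forall n, u n (b n) = 1).

Let q : R := 4^-1.

(* Each of the two choices for the [n]-th coefficient moves
   [s (b n) - s (a n)] by [0] or [q ^+ n], so one of them leaves it at least
   [q ^+ n / 2] away from zero, and all later terms sum to at most [q ^+ n / 3]. *)
Fixpoint separating_sum (n : nat) : T -> R := fun x =>
  if n isn't m.+1 then 0 else
  let s := separating_sum m in
  s x + (if q ^+ m / 2 <= `|s (b m) - s (a m)| then 0 else q ^+ m) * u m x.

Let s := separating_sum.

Let qn0 n : 0 < q ^+ n. Proof. by rewrite exprn_gt0// invr_gt0 ltr0n. Qed.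

Lemma separating_sum_continuous n : continuous (s n).
Proof.
elim: n => [|n IH] x; first exact: cvg_cst.
by apply: cvgD; [exact: IH|apply: cvgM; [exact: cvg_cst|exact: cu]].
Qed.

Lemma separating_sum_step n x : s n x <= s n.+1 x <= s n x + q ^+ n.
Proof.
have /andP[u0 u1] := u01 n x; have := qn0 n; rewrite /s /=.
by case: ifP => _ q0; apply/andP; split; nra.
Qed.

Lemma separating_sum_le n k x : s n x <= s (n + k) x.
Proof.
elim: k => [|k IH]; first by rewrite addn0.
by rewrite addnS (le_trans IH)//; have /andP[] := separating_sum_step (n + k) x.
Qed.

(** [4 / 3 * q ^+ n] is the whole geometric tail from [n] on, so it bounds everything that later
    steps can add. *)
Lemma separating_sum_ge n k x :
  s (n + k) x + 4 / 3 * q ^+ (n + k) <= s n x + 4 / 3 * q ^+ n.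
Proof.
elim: k => [|k IH]; first by rewrite addn0.
have /andP[_] := separating_sum_step (n + k) x.
rewrite addnS exprS; move: IH (qn0 (n + k)); rewrite /q; lra.
Qed.

Lemma separate_pairs : exists2 f : T -> R, continuous f & forall n, f (a n) <> f (b n).
Proof.
(* The sums increase with [n], so this supremum is their limit; the bracket [sf] makes the
   convergence uniform. *)
pose f x := sup (range (s ^~ x)).
have sf n x : s n x <= f x <= s n x + 4 / 3 * q ^+ n.
  have ubd : ubound (range (s ^~ x)) (s n x + 4 / 3 * q ^+ n).
    move=> _ [m _ <-].
    have [/subnKC<-|/ltnW/subnKC<-] := leqP n m.
      have := separating_sum_ge n (m - n) x; have := qn0 (n + (m - n)); lra.
    have := separating_sum_le m (n - m) x; have := qn0 (m + (n - m)); lra.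
  apply/andP; split; last by apply: ge_sup => //; exists (s n x), n.
  by apply: ub_le_sup; [exists (s n x + 4 / 3 * q ^+ n)|exists n].
exists f => [x|n fab].
  apply/cvgrPdist_lt => e e0.
  have [n qe] : exists n, q ^+ n < e / 4.
    by apply: expr_small; [rewrite /q; lra|rewrite divr_gt0// ltr0n].
  have e2 : 0 < e / 2 by rewrite divr_gt0// ltr0n.
  have /cvgrPdist_lt/(_ _ e2) := @separating_sum_continuous n x.
  apply: filterS => y; have := sf n x; have := sf n y.
  rewrite !ltr_norml => /andP[? ?] /andP[? ?] /andP[? ?].
  by apply/andP; split; lra.
(* A common value of [f] would put [s n.+1 (a n)] and [s n.+1 (b n)] within [4 / 3 * q ^+ n.+1],
   that is [q ^+ n / 3], of each other, while the choice of coefficient keeps them at least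
   [q ^+ n / 2] apart. *)
have := sf n.+1 (a n); have := sf n.+1 (b n); rewrite fab exprS.
rewrite /s /= -/s ua ub mulr0 mulr1 addr0; move: (qn0 n).
set Q := q ^+ n; rewrite /q; case: ifP => [+ ? /andP[? ?] /andP[? ?]|/negbT].
  by rewrite ler_normr => /orP[]; lra.
by rewrite -ltNge ltr_norml => /andP[? ?] ? /andP[? ?] /andP[? ?]; lra.
Qed.

End SeparatePairs.

Lemma connected_image_between (R : realType) (T : topologicalType) (A : set T)
    (f : T -> R) (x y : T) (r : R) : connected A -> continuous f -> A x -> A y ->
  f x <= r <= f y -> (f @` A) r.
Proof.
move=> cA cf Ax Ay; have /connected_intervalP : connected (f @` A).
  by apply: connected_continuous_connected => //; exact: continuous_subspaceT.
by apply; [exists x|exists y].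
Qed.

(** Rescaling [f] by its extrema gives minimum 0 and maximum 1, and connectedness of [K] gives
    surjectivity. Any nonempty open set contains a connected open one, on which two distinct values
    force a whole interval of values. *)
Lemma feebly_open_function (R : realType) (K : topologicalType) (f : K -> R) :
  connected [set: K] -> locally_connected K -> compact [set: K] ->
  continuous f -> (exists x : K, True) ->
  (forall V : set K, open V -> V !=set0 -> exists x y, [/\ V x, V y & f x <> f y]) ->
  exists p : K -> unit_interval R,
    [/\ continuous p, range p = setT & feebly_open p].
Proof.
move=> cK lK kK cf [x0 _] nc.
have K0 : [set: K] !=set0 by exists x0.
have cfT : {within [set: K], continuous f} by exact: continuous_subspaceT.
have [M _ fM] := compact_EVT_max K0 kK cfT.
have [m _ fm] := compact_EVT_min K0 kK cfT.
have {}fM x : f x <= f M by apply: fM; rewrite inE.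
have {}fm x : f m <= f x by apply: fm; rewrite inE.
have mM : 0 < f M - f m.
  have [x [y [_ _ fxy]]] := nc setT openT K0; rewrite subr_gt0 lt_neqAle.
  apply/andP; split; last exact: fM.
  apply/eqP => fmM; apply: fxy; apply/eqP; rewrite eq_le.
  by rewrite (le_trans (fM x)) -?fmM ?fm// (le_trans (fM y)) -?fmM ?fm.
pose g x := (f x - f m) / (f M - f m).
have g01 x : g x \in (`[0, 1]%classic : set R).
  rewrite inE /= in_itv /= divr_ge0 ?subr_ge0// ?(ltW mM)//=.
  by rewrite ler_pdivrMr// mul1r lerB.
have cg : continuous g.
  by move=> x; apply: cvgM; [apply: cvgB; [exact: cf|]|]; exact: cvg_cst.
have ltg x y : (g x < g y) = (f x < f y).
  by rewrite ltr_pM2r ?invr_gt0// ltrD2r.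
pose p x : unit_interval R := SigSub (g01 x).
exists p; split.
- exact: continuous_sub.
- apply/seteqP; split => // t _.
  have := valP t; rewrite inE /= in_itv /= => t01.
  have [|x _ gx] := @connected_image_between R K setT g m M (\val t) cK cg I I.
    by rewrite /g subrr mul0r divff ?gt_eqF.
  by exists x => //; apply: val_inj.
move=> U oU [x Ux].
have [V [oV Vx cV VU]] := lK x U (open_nbhs_nbhs (conj oU Ux)).
have [y [z [Vy Vz gyz]]] : exists y z, [/\ V y, V z & g y < g z].
  have [y [z [Vy Vz fyz]]] := nc V oV (ex_intro _ x Vx).
  have [?|?|//] := ltgtP (f y) (f z).
  - by exists y, z; rewrite ltg.
  - by exists z, y; rewrite ltg.
have mid r : g y < r < g z -> (g @` V) r.
  move=> /andP[yr rz]; apply: (@connected_image_between R K V g y z) => //.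
  by rewrite !ltW.
(* The midpoint is attained at some [w], so [p w] is a concrete interior point of the image. *)
have gyzm : g y < (g y + g z) / 2 < g z by apply/andP; split; lra.
have [w Vw gw] := mid _ gyzm.
exists (p w).
apply: (@filterS _ _ _ [set t : unit_interval R | g y < (\val t : R) < g z]).
  by move=> t /mid[v Vv gv]; exists v; [exact: VU|exact: val_inj].
apply: open_nbhs_nbhs; split; last by rewrite /= gw.
exists `]g y, g z[%classic; first exact: interval_open.
by apply/seteqP; split => t /=; rewrite in_itv.
Qed.

(** * Chains of connected open sets *)

Section Links.
Variables (R : realType) (K : metricType R).
Hypotheses (lK : locally_connected K) (kK : compact [set: K]).

(* The source and target are the points at which the curve is to enter and leave
   [ldom]; the core is the part of [ldom] it must cover. *)
Record link := Link {lsrc : K; ltgt : K; ldom : set K; lcore : set K}.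

Definition good_link (L : link) := [/\ open (ldom L), connected (ldom L),
  ldom L (lsrc L) /\ ldom L (ltgt L), closed (lcore L) /\ lcore L `<=` ldom L
  & (lcore L)° !=set0].

Definition fine_link (e : R) (W : set K) (L : link) := [/\ good_link L,
  (forall x y, ldom L x -> ldom L y -> mdist x y <= e) & ldom L `<=` W].

(** The end shared by consecutive good links lies in both domains; this is how neighbouring domains
    are known to meet. *)
Fixpoint chain (P : link -> Prop) (x : K) (s : seq link) (y : K) : Prop :=
  if s is L :: s' then [/\ P L, lsrc L = x & chain P (ltgt L) s' y] else x = y.

Definition covered (s : seq link) (y : K) :=
  exists s1 L s2, s = s1 ++ L :: s2 /\ lcore L y.

Lemma chain_cat P x s y s' z : chain P x s y -> chain P y s' z -> chain P x (s ++ s') z.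
Proof.
by elim: s x => [x ->|L s IH x [PL <- sy] s'z] //=; split => //; exact: IH.
Qed.

Lemma sub_chain (P Q : link -> Prop) x s y :
  (forall L, P L -> Q L) -> chain P x s y -> chain Q x s y.
Proof.
by move=> PQ; elim: s x => [//|L s IH x [PL <- sy]] /=; split; [exact: PQ| |exact: IH].
Qed.

Lemma chain_nth P x s y L0 i : chain P x s y -> (i < size s)%N -> P (nth L0 s i).
Proof.
elim: s x i => [//|L s IH x [|i] [PL _ sy]] //= si.
exact: IH sy si.
Qed.

Lemma chain_nthS P x s y L0 i : chain P x s y -> (i.+1 < size s)%N ->
  lsrc (nth L0 s i.+1) = ltgt (nth L0 s i).
Proof.
elim: s x i => [//|L s IH x [|i] [PL _ sy]] //= si; last exact: IH sy si.
by case: s sy si {IH} => [//|L' s] [].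
Qed.

Lemma covered_catl s s' y : covered s y -> covered (s ++ s') y.
Proof.
by move=> [s1 [L [s2 [-> Ly]]]]; exists s1, L, (s2 ++ s'); rewrite -catA.
Qed.

Lemma covered_catr s s' y : covered s' y -> covered (s ++ s') y.
Proof.
by move=> [s1 [L [s2 [-> Ly]]]]; exists (s ++ s1), L, s2; rewrite -catA.
Qed.

Lemma coveredP L0 s y : covered s y ->
  exists2 i, (i < size s)%N & lcore (nth L0 s i) y.
Proof.
move=> [s1 [L [s2 [-> Ly]]]]; exists (size s1).
  by rewrite size_cat /= -addSnnS leq_addr.
by rewrite nth_cat ltnn subnn.
Qed.

(** Local connectedness yields [V] inside the ball of radius [e / 2], and regularity a closed core
    inside [V]. Neither depends on the ends, so any two points of [V] are joined by a single
    link. *)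
Lemma fine_link_around (e : R) (W : set K) (x : K) : 0 < e -> open W -> W x ->
  exists V B : set K, [/\ nbhs x V, nbhs x B &
    forall y z, V y -> V z -> fine_link e W (Link y z V B)].
Proof.
move=> e0 oW Wx; have e2 : 0 < e / 2 by rewrite divr_gt0// ltr0n.
have [V [oV Vx cV VW]] : exists V : set K, [/\ open V, V x, connected V
    & V `<=` W `&` ball x (e / 2)].
  by apply: lK; apply: filterI; [exact: open_nbhs_nbhs|exact: nbhsx_ballx].
have [B Bx BV] : filter_from (nbhs x) closure V.
  by apply: uniform_regular; exact: open_nbhs_nbhs.
have CB : nbhs x (closure B) by apply: filterS Bx; exact: subset_closure.
exists V, (closure B); split => //; first exact: open_nbhs_nbhs.
move=> y z Vy Vz; split => /=.
- by split => //=; [split => //; exact: closed_closure|exists x].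
- move=> u v /VW[_ xu] /VW[_ xv].
  move: xu xv; rewrite !ballEmdist /= => xu xv.
  have := metric_triangle u x v; rewrite (metric_sym u x); lra.
- by move=> u /VW[].
Qed.

Section Refine.
Variables (e : R) (W : set K).
Hypotheses (e0 : 0 < e) (oW : open W) (cW : connected W).

(** The set [D] of points reachable from [x] is nonempty, open and closed in the connected set [W],
    since nearby points are joined by one link in either direction. *)
Lemma chain_within (x y : K) : W x -> W y ->
  exists s, chain (fine_link e W) x s y.
Proof.
move=> Wx.
pose D := [set z | W z /\ exists s, chain (fine_link e W) x s z].
suff DE : D = W by rewrite -{1}DE => -[].
have DW : W `&` D = D by apply/seteqP; split => [z [_ ?]|z [Wz ?]].
apply: cW.
- by exists x; split => //; exists [::].
- exists D => //; rewrite openE => z [Wz [s sz]].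
  have [V [B [zV _ VB]]] := fine_link_around e0 oW Wz.
  apply: (filterS _ zV) => v Vv; have Vz := nbhs_singleton zV.
  have [_ _ VW] := VB z v Vz Vv; split; first exact: VW.
  by exists (s ++ [:: Link z v V B]); apply: (chain_cat sz) => /=; split => //; exact: VB.
- exists (~` (W `\` D)); last first.
    by apply/seteqP; split => [z Dz|z [Wz]]; [split; [case: Dz|case]|
      move=> /not_andP[//|/contrapT]].
  rewrite closedC openE => z [Wz nDz].
  have [V [B [zV _ VB]]] := fine_link_around e0 oW Wz.
  apply: (filterS _ zV) => v Vv; have Vz := nbhs_singleton zV.
  have [_ _ VW] := VB v z Vv Vz; split; first exact: VW.
  move=> [Wv [s sv]]; apply: nDz; split => //.
  by exists (s ++ [:: Link v z V B]); apply: (chain_cat sv) => /=; split => //; exact: VB.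
Qed.

(** The near-covering form of compactness is applied to finite lists directed by inclusion; the list
    obtained is then filtered down to its points in [C]. *)
Lemma compact_subcover (C : set K) (B : K -> set K) : closed C ->
  (forall x, C x -> nbhs x (B x)) ->
  exists s : seq K, (forall x, x \in s -> C x) /\
    forall y, C y -> exists2 x, x \in s & B x y.
Proof.
move=> cC CB; have kC : compact C by exact: subclosed_compact cC kK _.
pose F : set_system (seq K) :=
  filter_from setT (fun s : seq K => [set s' : seq K | {subset s <= s'}]).
have FF : Filter F.
  apply: filter_from_filter; first by exists [::].
  move=> s t _ _; exists (s ++ t) => // r /= str.
  by split => x xs; apply: str; rewrite mem_cat xs ?orbT.
have [|s _ sP] := (compact_near_coveringP C).1 kC (seq K) F
    (fun s y => exists2 x, (x \in s) && `[< C x >] & B x y) FF.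
  move=> x Cx; exists (B x, [set s : seq K | {subset [:: x] <= s}]).
    by split => /=; [exact: CB|exists [:: x]].
  move=> [y s] /= [By xs]; exists x => //.
  by rewrite xs ?mem_head//; exact/asboolP.
exists [seq x <- s | `[< C x >]]; split.
  by move=> x; rewrite mem_filter => /andP[/asboolP].
move=> y Cy; have [//|x /andP[xs Cx] Bxy] := sP s _ y Cy.
by exists x => //; rewrite mem_filter Cx.
Qed.

(** Finitely many cores [B z] cover [C]. The chain visits their centres one after another, inserting
    at each [z] a link from [z] to itself with core [B z]. *)
Lemma covering_chain (C : set K) (x y : K) : closed C -> C `<=` W -> W x -> W y ->
  exists m, forall k, (m <= k)%N -> exists s, [/\ size s = k,
    chain (fine_link e W) x s y & C `<=` covered s].
Proof.
move=> cC CW Wx Wy.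
have /choice[V /choice[B VB]] : forall z, exists V B : set K, W z ->
    [/\ nbhs z V, nbhs z B & forall u v, V u -> V v -> fine_link e W (Link u v V B)].
  move=> z; have [Wz|nWz] := pselect (W z); last by exists setT, setT.
  by have [V [B ?]] := fine_link_around e0 oW Wz; exists V, B.
have VBl z : W z -> fine_link e W (Link z z (V z) (B z)).
  by move=> Wz; have [zV _ h] := VB z Wz; apply: h; exact: nbhs_singleton.
have [t [tC tcov]] : exists t : seq K, (forall z, z \in t -> C z) /\
    forall u, C u -> exists2 z, z \in t & B z u.
  by apply: compact_subcover => // z /CW/VB[].
have [s sxy st] : exists2 s, chain (fine_link e W) x s y &
    forall z, z \in t -> B z `<=` covered s.
  have {tC tcov} : forall z, z \in t -> W z by move=> z /tC/CW.
  elim: t x Wx => [|z t IH] x Wx tW.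
    by have [s sxy] := chain_within Wx Wy; exists s.
  have Wz : W z by apply: tW; rewrite mem_head.
  have [s1 s1xz] := chain_within Wx Wz.
  have [|s2 s2zy s2t] := IH z Wz.
    by move=> u ut; apply: tW; rewrite in_cons ut orbT.
  exists (s1 ++ Link z z (V z) (B z) :: s2).
    by apply: (chain_cat s1xz) => /=; split => //; exact: VBl.
  move=> u; rewrite in_cons => /orP[/eqP-> v zv|/s2t us2 v /us2 vs2].
    by exists s1, (Link z z (V z) (B z)), s2.
  by apply/covered_catr; exact: (@covered_catr [:: _]).
(* Padding makes the length prescribable, so that all links of a chain can be
   refined into equally many pieces. *)
exists (size s) => k sk; exists (s ++ nseq (k - size s) (Link y y (V y) (B y))); split.
- by rewrite size_cat size_nseq subnKC.
- apply: (chain_cat sxy); elim: (k - size s)%N => [|m IH] //=.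
  by split => //; exact: VBl.
- by move=> u /tcov[z zt] zu; apply/covered_catl; exact: st zu.
Qed.

End Refine.

(** Each link is cut into exactly [k] pieces, so [i %/ k] is the parent of piece [i], just as for
    cells of [0,1]; [L0] is the default of [nth]. *)
Definition refinement (e : R) (k : nat) (L0 : link) (s s' : seq link) :=
  [/\ size s' = (size s * k)%N,
   (forall i, (i < size s')%N ->
      fine_link e (ldom (nth L0 s (i %/ k))) (nth L0 s' i)) &
   (forall j y, (j < size s)%N -> lcore (nth L0 s j) y ->
      exists i, [/\ (i < size s')%N, (i %/ k)%N = j & lcore (nth L0 s' i) y])].

Lemma size_flatten_uniform (T : Type) (k : nat) (ss : seq (seq T)) :
  (forall r, List.In r ss -> size r = k) -> size (flatten ss) = (size ss * k)%N.
Proof.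
elim: ss => [//|r ss IH] h; rewrite /= size_cat h; last by left.
by rewrite IH ?mulSn// => r' r'ss; apply: h; right.
Qed.

Lemma nth_flatten_uniform (T : Type) (k : nat) (ss : seq (seq T)) (x0 : T) (i : nat) :
  (forall r, List.In r ss -> size r = k) -> (i < size ss * k)%N ->
  nth x0 (flatten ss) i = nth x0 (nth [::] ss (i %/ k)) (i %% k).
Proof.
move=> + ik; have k0 : (0 < k)%N by case: k ik => //; rewrite muln0.
elim: ss i ik => [//|r ss IH] i ik h; have rk : size r = k by apply: h; left.
rewrite /= nth_cat rk; case: ltnP => ki.
  by rewrite divn_small// modn_small.
rewrite -{2 3}(subnK ki) divnDr ?dvdnn// divnn k0 addn1 /= modnDr IH//.
  by rewrite ltn_subLR// -mulSn.
by move=> r' r'ss; apply: h; right.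
Qed.

(** Each good link can be cut into any sufficiently large number of pieces, so one [k] serves the
    whole finite chain. The pieces keep the ends of their link, hence their concatenation is again a
    chain. *)
Lemma refinement_exists (e : R) (L0 : link) (x : K) (s : seq link) (y : K) :
  0 < e -> chain good_link x s y ->
  exists k s', [/\ (1 < k)%N, chain good_link x s' y & refinement e k L0 s s'].
Proof.
move=> e0 sxy.
have /choice[m hm] : forall L, exists m, forall k, good_link L -> (m <= k)%N ->
    exists r, [/\ size r = k, chain (fine_link e (ldom L)) (lsrc L) r (ltgt L) &
      lcore L `<=` covered r].
  move=> L; have [[oL cL [Ls Lt] [cC CL] _]|nL] := pselect (good_link L);
    last by exists 0%N.
  by have [m hm] := covering_chain e0 oL cL cC CL Ls Lt; exists m => k _; exact: hm.
(* At least two pieces per link, so that the cells of [0,1] shrink to points. *)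
have [k k1 hk] : exists2 k, (1 < k)%N & forall L, List.In L s -> (m L <= k)%N.
  elim: s {sxy} => [|L s [k k1 hk]]; first by exists 2%N.
  exists (maxn (m L) k); first by rewrite leq_max k1 orbT.
  by move=> L' [<-|/hk h]; rewrite leq_max ?leqnn// h orbT.
have /choice[r hr] : forall L, exists r, good_link L -> List.In L s -> [/\ size r = k,
    chain (fine_link e (ldom L)) (lsrc L) r (ltgt L) & lcore L `<=` covered r].
  move=> L; have [[gL Ls]|nL] := pselect (good_link L /\ List.In L s).
    by have [r ?] := hm L k gL (hk L Ls); exists r.
  by exists [::] => gL Ls; exfalso; apply: nL.
have sg L : List.In L s -> good_link L.
  elim: s x sxy {hk hr} => [//|L' s IH] x [gL' _ sy] [<-//|]; exact: IH sy.
have rk r' : List.In r' (map r s) -> size r' = k.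
  by move=> /List.in_map_iff[L [<- Ls]]; have [] := hr L (sg L Ls) Ls.
have ssz : size (flatten (map r s)) = (size s * k)%N.
  by rewrite (size_flatten_uniform rk) size_map.
have k0 : (0 < k)%N by exact: ltnW.
have sIn j : (j < size s)%N -> List.In (nth L0 s j) s.
  elim: s j {sxy hk hr sg rk ssz} => [//|L s IH] [|j] /=; first by left.
  by move=> js; right; exact: IH.
have nthE i : (i < size s * k)%N ->
    nth L0 (flatten (map r s)) i = nth L0 (r (nth L0 s (i %/ k))) (i %% k).
  move=> ik; rewrite (nth_flatten_uniform _ rk) ?size_map//.
  by rewrite (nth_map L0)// ltn_divLR.
exists k, (flatten (map r s)); split => //; last split => //.
- elim: s x sxy hr {hk sg rk ssz sIn nthE} => [//|L s IH] x [gL <- sy] hr /=.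
  have [_ rL _] := hr L gL (or_introl erefl).
  apply: (@chain_cat _ _ _ (ltgt L)); first by apply: sub_chain rL => L' [].
  by apply: IH => // L' gL' L's; apply: hr => //; right.
- move=> i; rewrite ssz => ik; rewrite nthE//.
  have js : (i %/ k < size s)%N by rewrite ltn_divLR.
  have [sk rL _] := hr _ (sg _ (sIn _ js)) (sIn _ js).
  by apply: chain_nth rL _; rewrite sk ltn_mod.
- move=> j y' js yj; have [sk rL cv] := hr _ (sg _ (sIn _ js)) (sIn _ js).
  have [i ik iy] := coveredP L0 (cv _ yj).
  rewrite sk in ik.
  have jik : (j * k + i < size s * k)%N.
    apply: (@leq_trans (j.+1 * k)); first by rewrite mulSnr ltn_add2l.
    by rewrite leq_mul2r js orbT.
  have dk : ((j * k + i) %/ k)%N = j by rewrite divnMDl// divn_small// addn0.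
  exists (j * k + i)%N; split; [by rewrite ssz|by []|].
  by rewrite nthE// dk modnMDl modn_small.
Qed.

End Links.

(** * The limit curve of a sequence of refined chains *)

(* Level [n] cuts [0,1] into [N n] cells of equal length; the [j]-th cell is sent
   into [W n j] and onto a superset of the core [C n j]. *)
Section LimitCurve.
Variables (R : realType) (K : metricType R) (N k : nat -> nat)
  (W C : nat -> nat -> set K).
Hypotheses (kK : compact [set: K]) (N0 : (0 < N 0)%N)
  (Nk : forall n, N n.+1 = (N n * k n)%N) (k1 : forall n, (1 < k n)%N).
Hypotheses
  (Wd : forall n j x y, (j < N n)%N -> W n j x -> W n j y ->
    mdist x y <= 2^-1 ^+ n)
  (WS : forall n i, (i < N n.+1)%N -> W n.+1 i `<=` W n (i %/ k n))
  (Wadj : forall n j, (j.+1 < N n)%N -> W n j `&` W n j.+1 !=set0).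
Hypotheses
  (CW : forall n j, (j < N n)%N -> C n j `<=` W n j)
  (Ci : forall n j, (j < N n)%N -> (C n j)° !=set0)
  (CS : forall n j y, (j < N n)%N -> C n j y ->
    exists i, [/\ (i < N n.+1)%N, (i %/ k n)%N = j & C n.+1 i y])
  (C0 : forall y, exists2 j, (j < N 0)%N & C 0 j y).

Let I := unit_interval R.
Let q : R := 2^-1.

(** Cells are closed, so a division point belongs to two of them. *)
Definition in_cell (n j : nat) (t : R) :=
  (j < N n)%N && (j%:R <= t * (N n)%:R <= j.+1%:R).

Lemma cells_gt0 n : (0 < N n)%N.
Proof. by elim: n => // n IH; rewrite Nk muln_gt0 IH ltnW. Qed.

Let NR0 n : 0 < (N n)%:R :> R. Proof. by rewrite ltr0n cells_gt0. Qed.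

Lemma exp2_le_cells n : (2 ^ n <= N n)%N.
Proof. by elim: n => [|n IH]; rewrite ?expn0// Nk expnSr leq_mul. Qed.

Lemma in_cell_exists n (t : R) : 0 <= t <= 1 -> exists j, in_cell n j t.
Proof.
move=> /andP[t0 t1]; have tN0 : 0 <= t * (N n)%:R by rewrite mulr_ge0.
have /andP[lj jl] := truncn_itv tN0; set j := Num.truncn _ in lj jl.
have [jN|Nj] := ltnP j (N n).
  by exists j; rewrite /in_cell jN lj ltW.
(* Truncation overshoots only at [t = 1], which belongs to the last cell. *)
exists (N n).-1; rewrite /in_cell prednK ?cells_gt0// leqnn /=.
rewrite ler_piMl// andbT (le_trans _ lj)// ler_nat (leq_trans _ Nj)//.
exact: leq_pred.
Qed.

Lemma in_cell_parent n i (t : R) : in_cell n.+1 i t -> in_cell n (i %/ k n) t.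
Proof.
have k0 : (0 < k n)%N by exact: ltnW.
rewrite /in_cell Nk => /and3P[iN it ti]; rewrite ltn_divLR// iN /=.
have kR : 0 < (k n)%:R :> R by rewrite ltr0n.
rewrite natrM mulrA in it ti.
rewrite -(ler_pM2r kR) -natrM (le_trans _ it) ?ler_nat ?leq_divM//=.
rewrite -(ler_pM2r kR) -natrM (le_trans ti)// ler_nat.
by rewrite ltn_ceil.
Qed.

Lemma in_cell_ancestor n m i (t : R) : in_cell (n + m) i t ->
  exists2 j, in_cell n j t & W (n + m) i `<=` W n j.
Proof.
elim: m i => [|m IH] i; rewrite ?addn0; first by exists i.
rewrite addnS => it; have [j jt jW] := IH _ (in_cell_parent it).
exists j => //; apply: subset_trans jW; apply: WS.
by case/andP: it.
Qed.

(** Points less than one cell length apart lie in the same cell or in adjacent ones: the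
    inequalities give [j < i + 2]. *)
Lemma near_cells n i j (s t : R) : in_cell n i s -> in_cell n j t ->
  `|s - t| * (N n)%:R < 1 -> W n i `&` W n j !=set0.
Proof.
move=> si tj; wlog ij : i j s t si tj / (i <= j)%N.
  move=> h; have [ij|/ltnW ji] := leqP i j; first exact: h.
  by rewrite distrC setIC; exact: h.
move: si tj => /and3P[iN si is_] /and3P[jN tj jt].
rewrite -[X in _ * X]ger0_norm// -normrM mulrBl ltr_norml => /andP[st _].
have : (j%:R < i.+2%:R :> R) by rewrite -natr1; lra.
rewrite ltr_nat ltnS leq_eqVlt ltnS => /orP[/eqP ji|ji].
  by rewrite ji; apply: Wadj; rewrite -ji.
have -> : j = i by apply/eqP; rewrite eqn_leq ij ji.
by have [y /interior_subset/CW Wy] := Ci iN; exists y; split; exact: Wy.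
Qed.

(** [y] is the value of the limit curve at [t]. The factor 2 allows for two adjacent cells, each
    sent into a set of diameter at most [q ^+ n]. *)
Definition tracks (t : R) (y : K) := forall n j z,
  in_cell n j t -> W n j z -> mdist z y <= 2 * q ^+ n.

Lemma near_points n i j (s t : R) x y : in_cell n i s -> in_cell n j t ->
  `|s - t| * (N n)%:R < 1 -> W n i x -> W n j y -> mdist x y <= 2 * q ^+ n.
Proof.
move=> si tj st Wx Wy; have [z [Wiz Wjz]] := near_cells si tj st.
case/andP: si => iN _; case/andP: tj => jN _.
have := Wd iN Wx Wiz; have := Wd jN Wjz Wy.
have := metric_triangle x z y; rewrite /q; lra.
Qed.

(** Any cluster point [y] of points [u n] chosen in the sets of cells of [t] works: for [m >= n],
    [u m] also lies in the set of a level [n] cell of [t], hence within [2 * q ^+ n] of [z]. *)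
Lemma tracks_exists (t : R) : 0 <= t <= 1 -> exists y, tracks t y.
Proof.
move=> t01; have /choice[j jt] n := in_cell_exists n t01.
have /choice[u Wu] : forall n, exists x, W n (j n) x.
  move=> n; have /andP[jN _] := jt n.
  by have [y /interior_subset/CW Wy] := Ci jN; exists y; exact: Wy.
have [y [_ uy]] : [set: K] `&` cluster (u @ \oo) !=set0 by apply: kK; exact: filterT.
exists y => n i z zi Wz.
rewrite leNgt; apply/negP => zy.
pose e := mdist z y - 2 * q ^+ n.
have e0 : 0 < e by rewrite subr_gt0.
have un : (u @ \oo) [set u m | m in [set m | (n <= m)%N]].
  by exists n => // m /= nm; exists m.
have [_ [ [m nm <-] uym]] := uy _ _ un (nbhsx_ballx y e e0).
have [i' i't Wi'] : exists2 i', in_cell n i' t & W m (j m) `<=` W n i'.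
  by move: (jt m); rewrite /= in nm; rewrite -(subnKC nm); exact: in_cell_ancestor.
have := @near_points n i i' t t z (u m) zi i't.
rewrite subrr normr0 mul0r ltr01 => /(_ isT Wz (Wi' _ (Wu m))).
move: uym; rewrite ballEmdist /= metric_sym.
have := metric_triangle z (u m) y; rewrite /e; lra.
Qed.

(** Following [y] through the cores of successive levels gives nested cells [d m] with ends [l m]
    and [r m]. The supremum [t] of the left ends lies in all of them, so a point tracking [t] is
    arbitrarily close to [y]. *)
Lemma tracks_core n j y : (j < N n)%N -> C n j y ->
  exists t, [/\ 0 <= t <= 1, in_cell n j t & forall y', tracks t y' -> y' = y].
Proof.
move=> jN jy.
have /choice[f hf] : forall mi : nat * nat, exists i',
    (mi.2 < N mi.1)%N -> C mi.1 mi.2 y ->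
    [/\ (i' < N mi.1.+1)%N, (i' %/ k mi.1)%N = mi.2 & C mi.1.+1 i' y].
  move=> [m i] /=; have [[iN iy]|nh] := pselect ((i < N m)%N /\ C m i y).
    by have [i' ?] := CS iN iy; exists i'.
  by exists 0%N => ? ?; exfalso; apply: nh.
pose d := fix d m := if m is m'.+1 then f ((n + m')%N, d m') else j.
have dP m : (d m < N (n + m))%N /\ C (n + m) (d m) y.
  elim: m => [|m [mN my]]; first by rewrite addn0.
  by rewrite addnS /=; have [] := hf ((n + m)%N, d m) mN my.
have dS m : (d m.+1 %/ k (n + m))%N = d m.
  by have [mN my] := dP m; have [] := hf ((n + m)%N, d m) mN my.
pose l m : R := (d m)%:R / (N (n + m))%:R.
pose r m : R := (d m).+1%:R / (N (n + m))%:R.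
have lr m : l m <= r m by rewrite ler_pM2r ?invr_gt0// ler_nat.
have kR m : 0 < (k m)%:R :> R by rewrite ltr0n ltnW.
have lS m : l m <= l m.+1.
  rewrite ler_pdivlMr// addnS Nk natrM mulrA divfK ?gt_eqF//.
  by rewrite -natrM ler_nat -(dS m) leq_divM.
have rS m : r m.+1 <= r m.
  rewrite ler_pdivrMr// addnS Nk natrM mulrA divfK ?gt_eqF//.
  by rewrite -natrM ler_nat -(dS m) ltn_ceil// ltnW.
have lle m m' : l m <= l (m + m')%N.
  by elim: m' => [|m' IH]; rewrite ?addn0// addnS (le_trans IH).
have rle m m' : r (m + m')%N <= r m.
  by elim: m' => [|m' IH]; rewrite ?addn0// addnS (le_trans _ IH).
have lrs m m' : l m <= r m'.
  have [/subnKC<-|/ltnW/subnKC<-] := leqP m m'.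
    exact: le_trans (lle _ _) (lr _).
  exact: le_trans (lr _) (rle _ _).
pose t := sup (range l).
have lt m : l m <= t by apply: ub_le_sup; [exists (r 0%N) => _ [m' _ <-]|exists m].
have tr m : t <= r m by apply: ge_sup; [exists (l 0%N), 0%N|move=> _ [m' _ <-]].
have tcell m : in_cell (n + m) (d m) t.
  rewrite /in_cell (dP m).1 /=; apply/andP; split.
    by rewrite -ler_pdivrMr//; exact: lt.
  by rewrite -ler_pdivlMr//; exact: tr.
have t01 : 0 <= t <= 1.
  rewrite (le_trans _ (lt 0%N)) ?divr_ge0//= (le_trans (tr 0%N))//.
  by rewrite ler_pdivrMr// mul1r ler_nat (dP 0%N).1.
exists t; split => //; first by have := tcell 0%N; rewrite addn0.
move=> y' ty'; apply/esym/mdist_positivity/eqP; rewrite eq_le mdist_ge0 andbT.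
apply/ler_addgt0Pl => e e0; rewrite addr0.
have [m qe] : exists m, q ^+ m < e / 2.
  by apply: expr_small; [rewrite /q; lra|rewrite divr_gt0// ltr0n].
have [dN dy] := dP m; have := ty' _ _ _ (tcell m) (CW dN dy).
have : q ^+ (n + m) <= q ^+ m.
  by rewrite exprD ler_piMl ?exprn_ge0 ?exprn_ile1// /q; lra.
lra.
Qed.

Lemma limit_curve : exists h : I -> K,
  [/\ continuous h, range h = setT & feebly_open h].
Proof.
have val01 (t : I) : 0 <= (\val t : R) <= 1.
  by have := valP t; rewrite inE /= in_itv.
have /choice[h ht] : forall t : I, exists y, tracks (\val t) y.
  by move=> t; exact: tracks_exists.
have hC n j y : (j < N n)%N -> C n j y ->
    exists2 t : I, in_cell n j (\val t) & h t = y.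
  move=> jN jy; have [t [t01 tj ty]] := tracks_core jN jy.
  have t01' : t \in (`[0, 1]%classic : set R) by rewrite inE /= in_itv.
  by exists (SigSub t01') => //; apply: ty; exact: (ht (SigSub t01')).
exists h; split.
- move=> t; apply/(@metricType_numDomainType.cvgrPdist_lt R K I _ (nbhs_filter t)) => e e0.
  (* Both [h t] and [h s] are within [2 * q ^+ n] of a common point [z]. *)
  have [n qe] : exists n, q ^+ n < e / 4.
    by apply: expr_small; [rewrite /q; lra|rewrite divr_gt0// ltr0n].
  have tN : \forall s \near t, `|(\val s : R) - \val t| * (N n)%:R < 1.
    have cval : continuous (fun s : I => (\val s : R)) by exact: initial_continuous.
    have N1 : 0 < (N n)%:R^-1 :> R by rewrite invr_gt0.
    have /cvgrPdist_lt/(_ _ N1) := cval t; apply: filterS => s.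
    by rewrite distrC -ltr_pdivlMr// mul1r.
  apply: filterS tN => s st.
  have [j tj] := in_cell_exists n (val01 t); have [i si] := in_cell_exists n (val01 s).
  have [z [Wiz Wjz]] := near_cells si tj st.
  have := ht t _ _ _ tj Wjz; have := ht s _ _ _ si Wiz.
  have := metric_triangle (h t) z (h s); rewrite (metric_sym (h t) z); lra.
- apply/seteqP; split => // y _; have [j jN jy] := C0 y.
  by have [t _ <-] := hC _ _ _ jN jy; exists t.
- move=> U oU [t Ut].
  have : nbhs t U by exact: open_nbhs_nbhs.
  case=> _ [[V oV <-] /= Vt VU].
  have /nbhs_ballP[e /= e0 eV] : nbhs (\val t : R) V by exact: open_nbhs_nbhs.
  have [n qe] : exists n, q ^+ n < e.
    by apply: expr_small; rewrite // /q; lra.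
  (* A level [n] cell has length [1 / N n], so the cell of [t] stays inside the ball of radius [e],
     and its image contains a core. *)
  have Ne : (N n)%:R^-1 < e.
    apply: le_lt_trans qe; rewrite /q exprVn lef_pV2 ?posrE ?exprn_gt0//.
    by rewrite -natrX ler_nat exp2_le_cells.
  have [j tj] := in_cell_exists n (val01 t).
  have jN : (j < N n)%N by case/andP: tj.
  have [y yC] := Ci jN; exists y; apply: filterS yC => z /(hC _ _ _ jN)[s sj <-].
  exists s => //; apply: VU; apply: eV; change (`|(\val t : R) - \val s| < e).
  apply: le_lt_trans Ne; rewrite -[leRHS]mul1r ler_pdivlMr//.
  rewrite -[X in _ * X]ger0_norm// -normrM mulrBl ler_norml.
  move: sj tj => /and3P[_ + +] /and3P[_ + +]; rewrite -!natr1 => ? ? ? ?.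
  by apply/andP; split; lra.
Qed.

End LimitCurve.

(** * Feebly open surjections between [0, 1] and Peano continua *)

(** Refinement starts from a loop at [x0] whose domain and core are the whole space, so the cores of
    the first refinement already cover [K]. *)
Lemma feebly_open_curve (R : realType) (K : metricType R) (x0 : K) :
  peano_continuum K ->
  exists h : unit_interval R -> K,
    [/\ continuous h, range h = setT & feebly_open h].
Proof.
move=> [cK lK kK]; pose q : R := 2^-1.
have q0 n : 0 < q ^+ n by rewrite exprn_gt0// invr_gt0 ltr0n.
pose L0 := Link x0 x0 setT setT.
have gL0 : good_link L0.
  split => //=; first exact: openT.
  by rewrite interiorT; exists x0.
have /choice[nxt nxtP] : forall ns : nat * seq (link K), exists ks : nat * seq (link K),
    chain (@good_link R K) x0 ns.2 x0 ->
    [/\ (1 < ks.1)%N, chain (@good_link R K) x0 ks.2 x0 &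
      refinement (q ^+ ns.1) ks.1 L0 ns.2 ks.2].
  move=> [n s] /=; have [sx|ns] := pselect (chain (@good_link R K) x0 s x0).
    by have [k [s' ?]] := refinement_exists lK kK L0 (q0 n) sx; exists (k, s').
  by exists (0%N, [::]).
pose S := fix S n := if n is m.+1 then (nxt (m, S m)).2 else [:: L0].
pose k n := (nxt (n, S n)).1.
have Sc n : chain (@good_link R K) x0 (S n) x0.
  by elim: n => [//|n IH] /=; have [] := nxtP (n, S n) IH.
have k1 n : (1 < k n)%N by have [] := nxtP (n, S n) (Sc n).
have Sr n : refinement (q ^+ n) (k n) L0 (S n) (S n.+1).
  by have [] := nxtP (n, S n) (Sc n).
have S0 y : exists2 j, (j < size (S 1%N))%N & lcore (nth L0 (S 1%N) j) y.
  by have [_ _ /(_ 0%N y isT I)[i [iS _ iy]]] := Sr 0%N; exists i.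
(* Levels are shifted by one: the single link of [S 0] has no diameter bound, whereas those of
   [S n.+1] have diameter at most [q ^+ n]. *)
apply: (@limit_curve R K (fun n => size (S n.+1)) (fun n => k n.+1)
  (fun n j => ldom (nth L0 (S n.+1) j)) (fun n j => lcore (nth L0 (S n.+1) j))) => //.
- by have [j jS _] := S0 x0; exact: leq_ltn_trans jS.
- by move=> n; have [] := Sr n.+1.
- by move=> n j x y jS; have [_ /(_ j jS)[_ + _] _] := Sr n; exact.
- by move=> n i iS; have [_ /(_ i iS)[]] := Sr n.+1.
- move=> n j jS; exists (ltgt (nth L0 (S n.+1) j)).
  have [_ _ [_ jt] _ _] := chain_nth L0 (Sc n.+1) (ltnW jS).
  have [_ _ [js _] _ _] := chain_nth L0 (Sc n.+1) jS.
  by split => //; rewrite -(chain_nthS L0 (Sc n.+1) jS).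
- by move=> n j jS; have [_ _ _ [] _] := chain_nth L0 (Sc n.+1) jS.
- by move=> n j jS; have [] := chain_nth L0 (Sc n.+1) jS.
- by move=> n j y jS jy; have [_ _ h] := Sr n.+1; exact: h.
Qed.

(** Otherwise the singleton of [x] would be open and closed, hence all of [K]. *)
Lemma connected_no_isolated (R : realType) (K : metricType R) (x : K) (r : R) :
  connected [set: K] -> (exists y z : K, y <> z) -> 0 < r ->
  exists2 y, ball x r y & x <> y.
Proof.
move=> cK [y [z yz]] r0; apply: contrapT => nxr.
have xr : [set x] = ball x r.
  apply/seteqP; split => [_ ->|w xw]; first exact: ballxx.
  by apply: contrapT => /nesym xNw; apply: nxr; exists w.
have xT : [set x] = setT.
  apply: cK; first by exists x.
  - exists [set x]; last by rewrite setTI.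
    rewrite openE => _ ->; rewrite /interior xr; exact: nbhsx_ballx.
  - exists [set x]; last by rewrite setTI.
    exact/accessible_closed_set1/hausdorff_accessible/metric_hausdorff.
have : [set x] y by rewrite xT.
have : [set x] z by rewrite xT.
by move=> zx yx; apply: yz; rewrite yx zx.
Qed.

(** Every point of a finite [q ^+ n]-net is paired with a different point of its ball; the pairs
    over all [n] are countable and arbitrarily small near every point. *)
Lemma dense_pairs (R : realType) (K : metricType R) :
  connected [set: K] -> compact [set: K] -> (exists y z : K, y <> z) ->
  exists a b : nat -> K, (forall n, a n <> b n) /\
    forall V : set K, open V -> V !=set0 -> exists n, V (a n) /\ V (b n).
Proof.
move=> cK kK Knt; pose q : R := 2^-1.
have q0 n : 0 < q ^+ n by rewrite exprn_gt0// invr_gt0 ltr0n.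
have [x0 _] := Knt.
have /choice[s scov] : forall n, exists s : seq K,
    forall y, exists2 x, x \in s & ball x (q ^+ n) y.
  move=> n.
  have [|s [_ sP]] := @compact_subcover R K kK setT (fun x => ball x (q ^+ n)) closedT.
    by move=> x _; exact: nbhsx_ballx.
  by exists s => y; exact: sP.
have /choice[b bP] : forall nx : nat * K, exists y, ball nx.2 (q ^+ nx.1) y /\ nx.2 <> y.
  by move=> [n x]; have [y ? ?] := connected_no_isolated x cK Knt (q0 n); exists y.
(* [i] codes a level and a position in its net. The defaults are harmless, since [b] gives a
   distinct partner for every level and point. *)
pose c (i : nat) : nat * K :=
  let nj := odflt (0%N, 0%N) (unpickle i) in (nj.1, nth x0 (s nj.1) nj.2).
exists (fun i => (c i).2), (fun i => b (c i)); split => [i|V oV [v Vv]].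
  by have [] := bP (c i).
have /nbhs_ballP[e /= e0 eV] : nbhs v V by exact: open_nbhs_nbhs.
have [n qe] : exists n, q ^+ n < e / 2.
  by apply: expr_small; [rewrite /q; lra|rewrite divr_gt0// ltr0n].
have [x xs xv] := scov n v.
have cE : c (pickle (n, index x (s n))) = (n, x) by rewrite /c pickleK /= nth_index.
exists (pickle (n, index x (s n))).
suff : V (n, x).2 /\ V (b (n, x)) by rewrite -cE.
have [/= xb _] := bP (n, x).
split; apply: eV; move: xv xb; rewrite !ballEmdist /= => xv xb.
  by rewrite metric_sym; lra.
have := metric_triangle v x (b (n, x)); rewrite (metric_sym v x); lra.
Qed.

(** Urysohn functions for the pairs combine into one function separating all of them; as every
    nonempty open set contains a pair, it is constant on none. *)
Lemma feebly_open_to_interval (R : realType) (K : metricType R) :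
  peano_continuum K -> (exists y z : K, y <> z) ->
  exists p : K -> unit_interval R,
    [/\ continuous p, range p = setT & feebly_open p].
Proof.
move=> [cK lK kK] Knt; have [x0 _] := Knt.
have [a [b [ab abV]]] := dense_pairs cK kK Knt.
have /choice[u uP] : forall n, exists u : K -> R,
    [/\ continuous u, (forall x, 0 <= u x <= 1), u (a n) = 0 & u (b n) = 1].
  move=> n; have cb : closed [set b n].
    exact/accessible_closed_set1/hausdorff_accessible/metric_hausdorff.
  have /(point_uniform_separator cb)/(@uniform_separatorP _ R) : ~ [set b n] (a n).
    exact: ab.
  move=> /(_ R)[u [cu u01 ua ub]]; exists u; split => //.
  - by move=> x; have := u01 (u x); rewrite /= in_itv /=; apply; exists x.
  - by apply: ua; exists (a n).
  - by apply: ub; exists (b n).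
have [||||f cf fab] := @separate_pairs R K u a b; try by move=> n; have [] := uP n.
apply: (feebly_open_function cK lK kK cf); first by exists x0.
by move=> V oV V0; have [n [? ?]] := abV V oV V0; exists (a n), (b n).
Qed.

Unset Implicit Arguments.

Theorem theorem3p18 (R : realType) (X : topologicalType) (K : metricType R)
    (X_tychonoff : tychonoff_space X)
    (X_embed : forall A : set X,
      closed A -> separable_space (set_type A) -> Cstar_embedded R A)
    (K_peano : peano_continuum K)
    (K_nontrivial : exists x y : K, x <> y) :
  baire_space (Cp X (unit_interval R)) <-> baire_space (Cp X K).
Proof.
have [x0 _] := K_nontrivial.
have iI : interpolating X (unit_interval R) by exact: tychonoff_interpolating.
have [h [ch hs ho]] := feebly_open_curve x0 K_peano.
have [p [cp ps po]] := feebly_open_to_interval K_peano K_nontrivial.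
split; first exact: baire_postcomp ch hs ho iI.
(* Interpolation into [K] is inherited from [0,1] by lifting values along [h]. *)
exact: baire_postcomp cp ps po (interpolating_image ch hs iI).
Qed.
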